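(* Let $K$ be a field of characteristic $2$, let $q = 2^{\alpha}$ with $\alpha$ a positive integer, and let $C_q$ be a cyclic group of order $q$. Let $n$ be an integer with $q/2 < n \leq q$. Then $$S^2(V_n) \cong \wedge^2(V_{q-n}) \oplus V_q^{n-q/2} \oplus V_{q/2}$$ as $K[C_q]$-modules.
   Context: There are exactly $q$ indecomposable $K[C_q]$-modules up to isomorphism, $V_1, \ldots, V_q$, where $\dim V_i = i$ and a generator of $C_q$ acts on $V_i$ as a single $i \times i$ unipotent Jordan block. Set $V_0 = 0$. For a module $W$, $W^0 = 0$ and $W^d = W \oplus \cdots \oplus W$ ($d$ copies) for $d > 0$. $\wedge^2$ and $S^2$ denote the exterior square and the symmetric square (the quotient of $V \otimes V$ by the span of the elements $v \otimes w - w \otimes v$), with the induced group action. *)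

(* Defs.v *)
From HB Require Import structures.
From mathcomp Require Import all_boot all_order all_algebra.
From mathcomp Require Import all_fingroup all_solvable all_field all_character.

Set Implicit Arguments.
Unset Strict Implicit.
Unset Printing Implicit Defensive.

Import GroupScope GRing.Theory.
Local Open Scope ring_scope.

(* Representations act on row vectors, on the right.  The tensor square of    *)
(* rG is prod_repr rG rG, acting on 'rV_(n * n), in which the pure tensor of  *)
(* v and w is trow v w.                                                       *)

Section Relations.

Variables (K : fieldType) (n : nat).
Implicit Types v w : 'rV[K]_n.
Local Notation e i := (delta_mx 0 i : 'rV[K]_n).

Lemma trow_delta v w :
  trow v w = \sum_(i < n) \sum_(j < n)
    (v 0 i * w 0 j) *: trow (e i) (e j).
Proof.
rewrite {1}(row_sum_delta v) -trowbE linear_sum /=; apply: eq_bigr => i _.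
rewrite linearZ /= trowbE {1}(row_sum_delta w) linear_sum scaler_sumr /=.
by apply: eq_bigr => j _; rewrite linearZ /= scalerA.
Qed.

Lemma trow_tprod v w (A B : 'M[K]_n) :
  trow v w *m tprod A B = trow (v *m A) (w *m B).
Proof.
have tprod_row (a b : 'rV[K]_n) : usubmx (tprod a b : 'M_(1 + 0, _)) = trow a b.
  rewrite /= col_mxKu; congr (trow _ b).
  by apply/rowP=> i; rewrite mxE; congr (a _ _); apply: val_inj.
by rewrite -!tprod_row tprodE usumx_mul.
Qed.

(* Span of the v (x) w - w (x) v for all v and w: see sym_relP.               *)
Definition sym_rel : 'M[K]_(n * n) :=
  (\sum_(i < n) \sum_(j < n)
     <<trow (e i) (e j) - trow (e j) (e i)>>)%MS.

(* Span of the v (x) v for all v: see alt_relP.                               *)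
Definition alt_rel : 'M[K]_(n * n) :=
  (\sum_(i < n) (<<trow (e i) (e i)>> +
     \sum_(j < n)
       <<(trow (e i) (e j) + trow (e j) (e i))%R>>))%MS.

Lemma sym_relP m (U : 'M[K]_(m, n * n)) :
  (sym_rel <= U)%MS <-> forall v w, (trow v w - trow w v <= U)%MS.
Proof.
split=> [/sumsmx_subP sU v w | sU].
  have -> : trow w v =
      \sum_(i < n) \sum_(j < n) (v 0 i * w 0 j) *: trow (e j) (e i).
    rewrite trow_delta exchange_big /=; apply: eq_bigr => i _.
    by apply: eq_bigr => j _; rewrite mulrC.
  rewrite (trow_delta v w) -sumrB summx_sub // => i _.
  rewrite -sumrB summx_sub // => j _; rewrite -scalerBr scalemx_sub //.
  by have /sumsmx_subP/(_ j isT) := sU i isT; rewrite genmxE.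
by apply/sumsmx_subP=> i _; apply/sumsmx_subP=> j _; rewrite genmxE.
Qed.

Lemma alt_relP m (U : 'M[K]_(m, n * n)) :
  (alt_rel <= U)%MS <-> forall v, (trow v v <= U)%MS.
Proof.
split=> [/sumsmx_subP sU v | sU].
  have sUd i : (trow (e i) (e i) <= U)%MS.
    by have := sU i isT; rewrite addsmx_sub genmxE => /andP[].
  have sUs i j : ((trow (e i) (e j) + trow (e j) (e i))%R <= U)%MS.
    have := sU i isT; rewrite addsmx_sub => /andP[_ /sumsmx_subP sUi].
    by have := sUi j isT; rewrite genmxE.
  suff: forall r : seq 'I_n, ((\sum_(i <- r) \sum_(j <- r)
      (v 0 i * v 0 j) *: trow (e i) (e j))%R <= U)%MS.
    by move/(_ (index_enum _)); rewrite -trow_delta.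
  elim=> [|i r IHr]; first by rewrite big_nil sub0mx.
  rewrite big_cons big_cons.
  under [X in _ + X]eq_bigr do rewrite big_cons.
  rewrite big_split /= -addrA addmx_sub ?scalemx_sub // addrA addmx_sub //.
  rewrite -big_split summx_sub //= => j _.
  by rewrite [v 0 j * _]mulrC -scalerDr scalemx_sub.
apply/sumsmx_subP=> i _; rewrite addsmx_sub genmxE sU /=.
apply/sumsmx_subP=> j _; rewrite genmxE.
set a := e i; set b := e j.
have ->: trow a b + trow b a = trow (a + b) (a + b) - trow a a - trow b b.
  rewrite linearD /= -!(trowbE (a + b)) !linearD /= !trowbE.
  by rewrite addrA [RHS]addrAC addrK -[trow a a + _ + _]addrA addrAC subrr add0r addrC.
by rewrite !addmx_sub ?eqmx_opp.
Qed.

End Relations.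

Section Squares.

Variables (K : fieldType) (gT : finGroupType) (G : {group gT}).

Lemma sym_rel_mxmodule n (rG : mx_representation K G n) :
  mxmodule (prod_repr rG rG) (sym_rel K n).
Proof.
apply/mxmoduleP=> g Gg; set T := prod_repr rG rG g.
have TU : T \in unitmx by rewrite repr_mx_unit.
rewrite -(submxMfree _ _ (_ : row_free (invmx T))) ?mulmxK //; last first.
  by rewrite row_free_unit unitmx_inv.
apply/sym_relP=> v w; rewrite -(submxMfree _ _ (_ : row_free T)) ?row_free_unit //.
rewrite mulmxKV // mulmxBl !trow_tprod.
by have /sym_relP := submx_refl (sym_rel K n); apply.
Qed.

Lemma alt_rel_mxmodule n (rG : mx_representation K G n) :
  mxmodule (prod_repr rG rG) (alt_rel K n).
Proof.
apply/mxmoduleP=> g Gg; set T := prod_repr rG rG g.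
have TU : T \in unitmx by rewrite repr_mx_unit.
rewrite -(submxMfree _ _ (_ : row_free (invmx T))) ?mulmxK //; last first.
  by rewrite row_free_unit unitmx_inv.
apply/alt_relP=> v; rewrite -(submxMfree _ _ (_ : row_free T)) ?row_free_unit //.
rewrite mulmxKV // !trow_tprod.
by have /alt_relP := submx_refl (alt_rel K n); apply.
Qed.

Definition sym_square (W : representation K G) : representation K G :=
  Representation (factmod_repr (sym_rel_mxmodule W)).

Definition ext_square (W : representation K G) : representation K G :=
  Representation (factmod_repr (alt_rel_mxmodule W)).

End Squares.

Section JordanModules.

Variables (K : fieldType) (gT : finGroupType) (x : gT).

Definition jordan_block i : 'M[K]_i :=
  \matrix_(r, c) ((r == c) || (r.+1 == c :> nat))%:R.

Definition cycle_log (y : gT) : nat := invm (injm_Zpm x) y.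

Lemma cycle_logK y : y \in <[x]>%g -> (x ^+ cycle_log y)%g = y.
Proof.
move=> xy; have /= := invmK (injm_Zpm x); rewrite im_Zpm => /(_ y xy).
by rewrite /= /Zpm.
Qed.

(* x ^+ k acts as the k-th power of the Jordan block, which is well defined   *)
(* exactly when the block has order dividing #[x]; otherwise there is no such *)
(* representation and the value is the trivial one.  In characteristic p with *)
(* #[x] = p ^ a, the condition holds for all i <= p ^ a: see jordan_moduleE.  *)
Definition jordan_mx i (y : gT) : 'M[K]_i :=
  if jordan_block i ^+ #[x]%g == 1 then jordan_block i ^+ cycle_log y else 1%:M.

Lemma jordan_mx_repr i : mx_repr <[x]>%g (@jordan_mx i).
Proof.
rewrite /jordan_mx; case: eqP => [J1|_]; last by split=> [|y z _ _]; rewrite ?mulmx1.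
have Jmod a b : (x ^+ a = x ^+ b)%g -> jordan_block i ^+ a = jordan_block i ^+ b.
  move/eqP; rewrite eq_expg_mod_order => /eqP eq_ab.
  by rewrite -(expr_mod a J1) eq_ab expr_mod.
split=> [|y z xy xz].
  by rewrite (Jmod _ 0%N) ?expr0 // cycle_logK ?group1.
rewrite (Jmod _ (cycle_log y + cycle_log z)%N) ?exprD //.
by rewrite expgD !cycle_logK ?groupM.
Qed.

Definition jordan_module i : representation K <[x]>%G :=
  Representation (MxRepresentation (jordan_mx_repr i)).

Lemma jordan_block_exp p a i :
  p \in [pchar K] -> (i <= p ^ a)%N -> jordan_block i ^+ (p ^ a) = 1.
Proof.
case: i => [|i] pK le_i; first by apply/matrixP=> [[]].
pose N : 'M[K]_i.+1 := jordan_block i.+1 - 1.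
have NE r c : N r c = (r.+1 == c :> nat)%:R.
  rewrite !mxE -val_eqE /=; case: (val r =P val c) => [->|_]; last by rewrite subr0.
  by rewrite subrr eqn_leq ltnn.
have Nexp k r c : (N ^+ k) r c = (r + k == c)%N%:R.
  elim: k r c => [|k IHk] r c; first by rewrite expr0 mxE addn0.
  rewrite exprS mxE.
  have [lt_r | ge_r] := ltnP r.+1 i.+1.
    rewrite (bigD1 (Ordinal lt_r)) //= big1 => [|d ne_d].
      by rewrite NE IHk eqxx mul1r addr0 addSnnS.
    rewrite NE; case: eqP => [eq_d|_]; last by rewrite mul0r.
    by case/eqP: ne_d; apply: val_inj.
  rewrite big1 => [|d _].
    case: eqP => // rc; have := ltn_ord c.
    by rewrite -rc addnS ltnS ltnNge (leq_trans (_ : i <= r)%N) ?leq_addr.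
  rewrite NE; case: eqP => [rd|_]; last by rewrite mul0r.
  by have := ltn_ord d; rewrite -rd ltnNge ge_r.
have pM : p \in [pchar 'M[K]_i.+1] by rewrite pchar_lalg.
have -> : jordan_block i.+1 = 1 + N by rewrite addrC subrK.
have -> : (1 + N) ^+ (p ^ a) = 1 + N ^+ (p ^ a).
  elim: a {le_i} => [|a IHa]; first by rewrite !expr1.
  rewrite expnSr !exprM IHa -!(pFrobenius_autE pM).
  by rewrite pFrobenius_autD_comm ?pFrobenius_aut1 //; apply: commr_sym; apply: commr1.
have -> : N ^+ (p ^ a) = 0; last by rewrite addr0.
apply/matrixP=> r c; rewrite Nexp mxE; case: eqP => // rc.
by have := leq_trans (ltn_ord c) le_i; rewrite -rc ltnNge leq_addl.
Qed.

Lemma jordan_moduleE p a i :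
    p \in [pchar K] -> #[x]%g = (p ^ a)%N -> (i <= p ^ a)%N ->
  jordan_module i x = jordan_block i.
Proof.
move=> pK ox le_i; have J1 := jordan_block_exp pK le_i.
rewrite /= /jordan_mx ox J1 eqxx.
have /eqP := cycle_logK (cycle_id x).
rewrite -[X in _ == X]expg1 eq_expg_mod_order ox => /eqP eq_log.
by rewrite -(expr_mod _ J1) eq_log expr_mod ?expr1.
Qed.

End JordanModules.

(* Main.v *)
(* Write g for the action of x and r_k(M) for the rank of (g - 1)^k on M.     *)
(* Since g - 1 is nilpotent, the numbers r_k(M) determine M, so it suffices   *)
(* to compare them.  With m = q - n, h = q / 2 and V_q / V_m = V_n, the       *)
(* Koszul complex                                                             *)
(*   0 -> wedge^2 V_m -> wedge^2 V_q -> V_n (x) V_q -> S^2 V_n -> 0           *)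
(* is exact, and V_n (x) V_q is free, so that the image of (g - 1)^k on it is *)
(* the kernel of (g - 1)^(q - k).  Moreover wedge^2 V_q is the sum of a free  *)
(* module of rank h - 1 and a copy of V_h, the orbits of the pairs {i, i + d} *)
(* with d < h and d = h respectively; as V_m lies in (g - 1)^h V_q =          *)
(* (g^h - 1) V_q, the image of wedge^2 V_m lies in a free summand.  These     *)
(* facts give r_k(S^2 V_n) in terms of r_k(wedge^2 V_m).                      *)
(*                                                                            *)
(* A tensor is a square matrix A, flattened by mxvec, on which g acts by      *)
(* A |-> g^T A g; in characteristic 2 the exterior square is identified with  *)
(* the image of A |-> A - A^T, whose kernel is spanned by the v (x) v.        *)

(* Nilpotent matrices are similar as soon as their powers have equal ranks ([nilp_rank_sim]), so by
   [cycle_rsim] the theorem amounts to the formula r_k(S^2 V_n) = r_k(wedge^2 V_m) + (n - h)(q - k)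
   + (h - k), with truncated subtractions, which is [unip_rank_sym].

   Put j = q - k and let M be the kernel of V_n (x) V_q -> S^2 V_n. Since V_n (x) V_q is free of
   rank n ([rank_tens_rot]), r_k(S^2 V_n) = n j - dim M + r_j(M). By [koszul_exact_sym] and
   [koszul_exact_ext], M is wedge^2 V_q modulo wedge^2 V_m. So r_j(M) is r_j(wedge^2 V_q), given by
   [rank_alt_rot2], minus the dimension of the part of wedge^2 V_m lying in (g - 1)^j wedge^2 V_q.
   By [alt_half_exact] that part is the whole kernel of (g - 1)^k on wedge^2 V_m, which brings in
   r_k(wedge^2 V_m). *)
Require Import Defs.
From HB Require Import structures.
From mathcomp Require Import all_boot all_order all_algebra.
From mathcomp Require Import all_fingroup all_solvable all_field all_character.
From mathcomp Require Import zify.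

Set Implicit Arguments.
Unset Strict Implicit.
Unset Printing Implicit Defensive.

Import GRing.Theory.
Local Open Scope nat_scope.

(** * Nilpotent matrices up to similarity *)

Section NilpotentSimilarity.

Variable K : fieldType.
Local Open Scope ring_scope.

Lemma expmxS n (A : 'M[K]_n) k : A ^+ k.+1 = A *m A ^+ k.
Proof. exact: exprS. Qed.

Lemma expmxSr n (A : 'M[K]_n) k : A ^+ k.+1 = A ^+ k *m A.
Proof. exact: exprSr. Qed.

Lemma expmxD n (A : 'M[K]_n) j k : A ^+ (j + k) = A ^+ j *m A ^+ k.
Proof. exact: exprD. Qed.

Lemma intertwine_exp m n (A : 'M[K]_m) (B : 'M[K]_n) (P : 'M_(m, n)) k :
  A *m P = P *m B -> A ^+ k *m P = P *m B ^+ k.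
Proof.
move=> AP; elim: k => [|k IHk]; first by rewrite !expr0 mul1mx mulmx1.
by rewrite expmxSr -mulmxA AP mulmxA IHk -mulmxA -expmxSr.
Qed.

Lemma block_diag_exp m n (A : 'M[K]_m) (B : 'M[K]_n) k :
  block_mx A 0 0 B ^+ k = block_mx (A ^+ k) 0 0 (B ^+ k).
Proof.
elim: k => [|k IHk]; first by rewrite !expr0 -scalar_mx_block.
by rewrite !expmxS IHk mulmx_block !mulmx0 !mul0mx !addr0 add0r.
Qed.

Lemma rank_conj m n (A : 'M[K]_m) (B : 'M[K]_n) (P : 'M_(m, n)) k :
  m = n -> row_free P -> A *m P = P *m B -> \rank (A ^+ k) = \rank (B ^+ k).
Proof.
move=> eq_mn freeP AP; rewrite -(mxrankMfree _ freeP) (intertwine_exp k AP).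
rewrite (eqmxMfull (B ^+ k)) //.
by rewrite /row_full (eqP (_ : row_free P)) ?eq_mn.
Qed.

Lemma nilp_exp0 n (A : 'M[K]_n) t k : A ^+ t = 0 -> (t <= k)%N -> A ^+ k = 0.
Proof. by move=> At le_tk; rewrite -(subnK le_tk) expmxD At mulmx0. Qed.

(** One family covers the nilpotent Jordan block (square, [k = 1]), the inclusion of a tail of the
    basis and the truncation onto an initial segment. *)
Definition jump_mx m n k : 'M[K]_(m, n) := \matrix_(i, j) (i + k == j)%N%:R.

Notation shift_mx n := (jump_mx n n 1).

Lemma mul_jump_mx n p q k (A : 'M[K]_(p, q)) (i : 'I_n) j
    (lt_ik : (i + k < p)%N) :
  (jump_mx n p k *m A) i j = A (Ordinal lt_ik) j.
Proof.
rewrite mxE (bigD1 (Ordinal lt_ik)) //= big1 => [|l ne_l].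
  by rewrite mxE eqxx mul1r addr0.
rewrite mxE; case: eqP => [eq_l|_]; last by rewrite mul0r.
by case/eqP: ne_l; apply: val_inj.
Qed.

Lemma mul_jump_mx0 n p q k (A : 'M[K]_(p, q)) (i : 'I_n) j :
  (p <= i + k)%N -> (jump_mx n p k *m A) i j = 0.
Proof.
move=> le_p; rewrite mxE big1 // => l _; rewrite mxE.
by case: eqP => [eq_l|_]; [have := ltn_ord l; lia | rewrite mul0r].
Qed.

(** The hypothesis says that an index falling off the middle space would also fall off the last
    one. *)
Lemma jump_mxM m n p k l :
  (p <= n + l)%N -> jump_mx m n k *m jump_mx n p l = jump_mx m p (k + l).
Proof.
move=> le_p; apply/matrixP => i j; rewrite [RHS]mxE.
have [le_n | lt_ik] := leqP n (i + k).
  by rewrite mul_jump_mx0 //; case: eqP => // eq_j; have := ltn_ord j; lia.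
by rewrite mul_jump_mx mxE /= addnA.
Qed.

Lemma jump_mx1 n : jump_mx n n 0 = 1%:M.
Proof. by apply/matrixP => i j; rewrite !mxE addn0. Qed.

Lemma jump_mx_out m n k : (n <= k)%N -> jump_mx m n k = 0.
Proof.
move=> le_nk; apply/matrixP => i j; rewrite !mxE.
by case: eqP => // eq_j; have := ltn_ord j; lia.
Qed.

Lemma jump_mx_exp n k : shift_mx n ^+ k = jump_mx n n k.
Proof.
elim: k => [|k IHk]; first by rewrite expr0 jump_mx1.
by rewrite expmxS IHk jump_mxM ?leq_addr.
Qed.

Lemma jump_mx_full m n : (n <= m)%N -> row_full (jump_mx m n 0).
Proof.
move=> le_nm; apply/row_fullP; exists (jump_mx n m 0).
by rewrite jump_mxM ?addn0 // jump_mx1.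
Qed.

Lemma jump_mx_free m n k : (m + k <= n)%N -> row_free (jump_mx m n k).
Proof.
move=> le_mk; apply/row_freeP; exists (\matrix_(j, i) (i + k == j)%N%:R).
apply/matrixP => i j; have lt_ik : (i + k < n)%N by have := ltn_ord i; lia.
by rewrite mul_jump_mx !mxE /= eqn_add2r eq_sym.
Qed.

Lemma rank_shift n k : \rank (shift_mx n ^+ k) = (n - k)%N.
Proof.
rewrite jump_mx_exp -(@jump_mxM n (n - k) n 0 k); last by lia.
rewrite (eqmxMfull (jump_mx (n - k) n k)) ?jump_mx_full ?leq_subr //.
have [le_kn | lt_nk] := leqP k n.
  by apply/eqP/jump_mx_free; rewrite subnK.
by rewrite jump_mx_out ?mxrank0 1?ltnW //; lia.
Qed.

Definition krylov_mx n t (v : 'rV[K]_n) (A : 'M[K]_n) :=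
  \matrix_(i < t) (v *m A ^+ i).

Lemma krylov_shift n t (v : 'rV[K]_n) (A : 'M[K]_n) :
  v *m A ^+ t = 0 -> shift_mx t *m krylov_mx t v A = krylov_mx t v A *m A.
Proof.
move=> vAt; apply/row_matrixP => i.
rewrite [RHS]row_mul rowK -mulmxA -expmxSr; apply/rowP => j; rewrite mxE.
have [lt_i | ge_i] := ltnP (i + 1) t.
  by rewrite mul_jump_mx [LHS]mxE /= addn1.
by rewrite mul_jump_mx0 // (_ : i.+1 = t) ?vAt ?mxE //; have := ltn_ord i; lia.
Qed.

(* If v A^t <> 0 = v A^(t+1) and the functional u does not vanish on v A^t,   *)
(* then the largest A-stable subspace of ker u is a complement of the cyclic  *)
(* space generated by v.                                                      *)
Lemma split_cyclic m t (A : 'M[K]_m) : A ^+ t.+1 = 0 -> A ^+ t != 0 ->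
  exists m' (A' : 'M[K]_m') (Q : 'M_(t.+1 + m', m)),
    [/\ m = (t.+1 + m')%N, row_free Q
      & block_mx (shift_mx t.+1) 0 0 A' *m Q = Q *m A].
Proof.
move=> At1 /rowV0Pn [w0 /submxP [v ->] vAt].
have {w0} [u uP] : exists u : 'cV[K]_m, v *m A ^+ t *m u = 1.
  have /rV0Pn [j nz_j] := vAt; move: (v *m _) nz_j => w nz_j.
  exists ((w 0 j)^-1 *: delta_mx j 0); rewrite -scalemxAr -colE.
  by apply/matrixP => a b; rewrite !ord1 !mxE mulVf.
pose Z := krylov_mx t.+1 v A.
pose F := \matrix_(i < m, j < t.+1) (A ^+ (t - j) *m u) i 0.
have FE k (w : 'M_(k, m)) i j : (w *m F) i j = (w *m A ^+ (t - j) *m u) i 0.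
  by rewrite -mulmxA !mxE; apply: eq_bigr => l _; rewrite [F _ _]mxE.
have ZFE (i j : 'I_t.+1) : (Z *m F) i j = (v *m A ^+ (i + (t - j)) *m u) 0 0.
  have -> : (Z *m F) i j = (row i (Z *m F)) 0 j by rewrite [RHS]mxE.
  by rewrite row_mul rowK FE expmxD !mulmxA.
(* [Z *m F] is triangular with 1 on the diagonal, because powers of [A] above [t] vanish. *)
have ZF : \rank (Z *m F) = t.+1.
  apply/eqP; rewrite -/(row_free _) row_free_unit unitmxE -det_tr det_trig.
    rewrite big1 ?unitr1 // => i _.
    by rewrite mxE ZFE subnKC -1?ltnS // uP mxE eqxx.
  apply/is_trig_mxP => i j lt_ij; rewrite mxE ZFE (nilp_exp0 At1).
    by rewrite mulmx0 mul0mx mxE.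
  by have := ltn_ord i; lia.
have rkF : \rank F = t.+1.
  by apply/eqP; rewrite eqn_leq rank_leq_col -{1}ZF mxrankM_maxr.
have rkZ : \rank Z = t.+1.
  by apply/eqP; rewrite eqn_leq rank_leq_row -{1}ZF mxrankM_maxl.
have rkW : (t.+1 + \rank (kermx F))%N = m.
  by rewrite mxrank_ker rkF subnKC // -rkF rank_leq_row.
have /submxP [A' A'P] : (row_base (kermx F) *m A <= row_base (kermx F))%MS.
  rewrite (eqmxMr _ (eq_row_base _)) eq_row_base sub_kermx.
  apply/eqP/matrixP => i j.
  (* The columns of [F] test the exponents up to [t], and larger ones give 0; hence the kernel of
     [F] is stable under [A]. *)
  have ker0 l : row i (kermx F) *m A ^+ l *m u = 0.
    have [le_lt | lt_tl] := leqP l t; last first.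
      by rewrite (nilp_exp0 At1) ?mulmx0 ?mul0mx.
    have lt : (t - l < t.+1)%N by rewrite ltnS leq_subr.
    have /rowP/(_ (Ordinal lt)) : row i (kermx F) *m F = 0.
      by rewrite -row_mul mulmx_ker row0.
    rewrite FE /= subKn // => kF0; apply/matrixP => a b.
    by rewrite !ord1 kF0 !mxE.
  have -> : (kermx F *m A *m F) i j = (row i (kermx F) *m A *m F) 0 j.
    by rewrite -!row_mul [RHS]mxE.
  by rewrite FE -(mulmxA _ A) -expmxS ker0 !mxE.
exists (\rank (kermx F)), A', (col_mx Z (row_base (kermx F))); split=> //.
  rewrite /row_free -addsmxE mxrank_disjoint_sum ?eq_row_base ?rkZ //.
  apply/eqP; rewrite -mxrank_eq0 (cap_eqmx (eqmx_refl Z) (eq_row_base _)).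
  by rewrite -(eqn_add2l (\rank (Z *m F))) mxrank_mul_ker ZF rkZ addn0.
rewrite mul_block_col !mul0mx addr0 add0r mul_col_mx -A'P; congr col_mx.
by apply: krylov_shift; rewrite At1 mulmx0.
Qed.

(** The ranks force a common nilpotency index t + 1. Both matrices then split off a Jordan block of
    that size by [split_cyclic], and the ranks on the complements agree by subtraction, so induction
    applies. *)
Lemma nilp_rank_sim m n (A : 'M[K]_m) (B : 'M[K]_n) N :
    A ^+ N = 0 -> (forall k, \rank (A ^+ k) = \rank (B ^+ k)) ->
  exists P : 'M_(m, n), [/\ m = n, row_free P & A *m P = P *m B].
Proof.
elim/ltn_ind: m n A B N => m IHm n A B N AN eq_rk.
have eq_mn : m = n by have := eq_rk 0%N; rewrite !expr0 !mxrank1.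
case: (posnP m) => [m0 | m_gt0].
  exists 0; split=> //; first by rewrite /row_free mxrank0 m0.
  by rewrite mulmx0 mul0mx.
have A0 : A ^+ 0 != 0 by rewrite -mxrank_eq0 expr0 mxrank1 -lt0n.
have [t At1 At] : exists2 t, A ^+ t.+1 = 0 & A ^+ t != 0.
  elim: N AN => [/eqP|N IHN AN]; first by rewrite (negPf A0).
  by have [/IHN //|] := eqVneq (A ^+ N) 0; exists N.
have Bt1 : B ^+ t.+1 = 0 by apply/eqP; rewrite -mxrank_eq0 -eq_rk At1 mxrank0.
have Bt : B ^+ t != 0 by rewrite -mxrank_eq0 -eq_rk mxrank_eq0.
have [m' [A' [Q [eq_m freeQ QA]]]] := split_cyclic At1 At.
have [n' [B' [S [eq_n freeS SB]]]] := split_cyclic Bt1 Bt.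
have lt_m'm : (m' < m)%N by rewrite eq_m addSn ltnS leq_addl.
have eq_rk' k : \rank (A' ^+ k) = \rank (B' ^+ k).
  have := eq_rk k; rewrite -(rank_conj k (esym eq_m) freeQ QA).
  rewrite -(rank_conj k (esym eq_n) freeS SB) !block_diag_exp.
  rewrite !rank_diag_block_mx.
  exact: addnI.
have A'N : A' ^+ t.+1 = 0.
  have := mxrank0 K m m; rewrite -At1 -(rank_conj _ (esym eq_m) freeQ QA).
  rewrite block_diag_exp rank_diag_block_mx => /eqP.
  by rewrite addn_eq0 !mxrank_eq0 => /andP [_ /eqP].
have [P' [eq_m' freeP' A'P']] := IHm _ lt_m'm _ _ _ _ A'N eq_rk'.
have [Q' invQ QP] : exists2 Q', Q' *m Q = 1%:M & Q *m Q' = 1%:M.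
  exists (pinvmx Q); rewrite (mulVpmx, mulmxVp) //.
  by rewrite /row_full (eqP freeQ) eq_m.
(* Pass to the block form of [A], match the blocks, and return through the block form of [B]. *)
exists (Q' *m block_mx 1%:M 0 0 P' *m S); split=> //.
  rewrite /row_free mxrankMfree // (eqmxMfull (block_mx _ _ _ _)).
    by rewrite rank_diag_block_mx mxrank1 (eqP freeP') eq_m.
  rewrite /row_full eqn_leq rank_leq_col -{1}(mxrank1 K (t.+1 + m')) -QP.
  exact: mxrankM_maxr.
have -> : A = Q' *m block_mx (shift_mx t.+1) 0 0 A' *m Q.
  by rewrite -mulmxA QA mulmxA invQ mul1mx.
rewrite -[RHS]mulmxA -SB !mulmxA -(mulmxA _ Q) QP mulmx1.
rewrite -!(mulmxA (Q')) !mulmx_block !mulmx0 !mul0mx !addr0 !add0r.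
by rewrite mulmx1 mul1mx A'P'.
Qed.

End NilpotentSimilarity.

(** * Rank invariants of representations of a cyclic p-group *)

Notation shift_mx K n := (jump_mx K n n 1).

Section CyclicRepresentations.

Variable K : fieldType.
Local Open Scope ring_scope.

(** Each further power loses at most [c] in rank, yet [q] steps lose [q * c]; so every step loses
    exactly [c]. *)
Lemma nilp_free_rank q c n (A : 'M[K]_n) k :
  n = (q * c)%N -> A ^+ q = 0 -> (\rank (kermx A) <= c)%N ->
  \rank (A ^+ k) = ((q - k) * c)%N.
Proof.
move=> eq_n Aq kerA.
have step j : (\rank (A ^+ j) <= \rank (A ^+ j.+1) + c)%N.
  rewrite expmxSr -{1}(mxrank_mul_ker (A ^+ j) A) leq_add2l.
  exact: leq_trans (mxrankS (capmxSr _ _)) kerA.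
have lower j : (q * c <= \rank (A ^+ j) + j * c)%N.
  elim: j => [|j IHj]; first by rewrite expr0 mxrank1 addn0 eq_n.
  by rewrite (leq_trans IHj) // mulSn addnA leq_add2r.
have upper j : (j <= q -> \rank (A ^+ (q - j)) <= j * c)%N.
  elim: j => [|j IHj] lt_jq; first by rewrite subn0 Aq mxrank0.
  rewrite (leq_trans (step _)) // -subSn // subSS mulSn addnC leq_add2l IHj //.
  exact: ltnW.
have [le_kq | lt_qk] := leqP k q.
  apply/eqP; rewrite eqn_leq -{1}(subKn le_kq) upper ?leq_subr //=.
  by rewrite mulnBl leq_subLR addnC lower.
by rewrite (nilp_exp0 Aq (ltnW lt_qk)) mxrank0 (eqP (ltnW lt_qk)).
Qed.

Lemma rank_ker_leq m n c (A : 'M[K]_(m, n)) (W : 'M_(c, m)) :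
  (forall v : 'rV_m, v *m A = 0 -> (v <= W)%MS) -> (\rank (kermx A) <= c)%N.
Proof.
move=> kerW; apply: leq_trans (rank_leq_row W); apply: mxrankS.
by apply/row_subP => i; apply: kerW; rewrite -row_mul mulmx_ker row0.
Qed.

Lemma exp_pchar_sub1 p a n (A : 'M[K]_n) :
  p \in [pchar K] -> (A - 1) ^+ (p ^ a) = A ^+ (p ^ a) - 1.
Proof.
case: n A => [|n] A pK; first by apply/matrixP => [[]].
have pM : p \in [pchar 'M[K]_n.+1] by rewrite pchar_lalg.
elim: a => [|a IHa]; first by rewrite !expr1.
rewrite expnSr !exprM IHa -!(pFrobenius_autE pM).
by rewrite pFrobenius_autB_comm ?pFrobenius_aut1 //; apply: commr1.
Qed.

Lemma jordan_block_sub1 n : jordan_block K n - 1 = shift_mx K n.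
Proof.
apply/matrixP => i j; rewrite !mxE addn1 -val_eqE /=.
case: (val i =P val j) => [->|_]; last by rewrite subr0.
by rewrite subrr eqn_leq ltnn.
Qed.

Lemma rank_jordan n k : \rank ((jordan_block K n - 1) ^+ k) = (n - k)%N.
Proof. by rewrite jordan_block_sub1 rank_shift. Qed.

Lemma repr_mx_exp (gT : finGroupType) (G : {group gT}) n
    (rG : mx_representation K G n) g k :
  g \in G -> rG (g ^+ k)%g = rG g ^+ k.
Proof.
move=> Gg; elim: k => [|k IHk]; first by rewrite expg0 repr_mx1.
by rewrite expgS repr_mxM ?groupX // IHk expmxS.
Qed.

Lemma factmod_proj (gT : finGroupType) (G : {group gT}) n
    (rG : mx_representation K G n) (U : 'M_n) (modU : mxmodule rG U) :
  exists p : 'M_(n, \rank (cokermx U)),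
    [/\ row_full p, forall m (A : 'M_(m, n)), (A *m p == 0) = (A <= U)%MS
      & forall g, g \in G -> rG g *m p = p *m factmod_repr modU g].
Proof.
exists (in_factmod U 1%:M); split.
- apply/row_fullP; exists (val_factmod 1%:M).
  by rewrite -in_factmodE val_factmodK.
- by move=> m A; rewrite -in_factmodE in_factmod_eq0.
- by move=> g Gg; rewrite -in_factmodE -in_factmodJ // mul1mx.
Qed.

Variables (gT : finGroupType) (x : gT).

Definition unip_rank (W : representation K <[x]>) k := \rank ((W x - 1) ^+ k).

Lemma unip_rank_add (W1 W2 : representation K <[x]>) k :
  unip_rank (dadd_grepr W1 W2) k = (unip_rank W1 k + unip_rank W2 k)%N.
Proof.
rewrite /unip_rank /= -rank_diag_block_mx -block_diag_exp.
congr (\rank (_ ^+ _)).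
by rewrite [1 in LHS](scalar_mx_block _ _ 1) opp_block_mx add_block_mx !subr0.
Qed.

Lemma unip_rank_muln (W : representation K <[x]>) m k :
  unip_rank (muln_grepr W m) k = (m * unip_rank W k)%N.
Proof.
rewrite /muln_grepr; elim: m => [|m IHm].
  by rewrite big_ord0; apply/eqP; rewrite -leqn0 rank_leq_row.
by rewrite big_ord_recl unip_rank_add IHm.
Qed.

(** By Frobenius [W1 x - 1] is nilpotent, and a matrix that intertwines the generators intertwines
    all their powers. *)
Lemma cycle_rsim p a (W1 W2 : representation K <[x]>) :
    p \in [pchar K] -> #[x]%g = (p ^ a)%N ->
    (forall k, unip_rank W1 k = unip_rank W2 k) ->
  mx_rsim W1 W2.
Proof.
move=> pK ox eq_rk.
have X1 : W1 x ^+ (p ^ a) = 1.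
  by rewrite -ox -repr_mx_exp ?cycle_id // expg_order repr_mx1.
have N1 : (W1 x - 1) ^+ (p ^ a) = 0 by rewrite exp_pchar_sub1 // X1 subrr.
have [P [eq_n freeP sim]] := nilp_rank_sim N1 eq_rk.
exists P => // _ /cycleP [k ->].
rewrite !repr_mx_exp ?cycle_id //; apply: intertwine_exp.
by move: sim; rewrite mulmxBl mulmxBr mul1mx mulmx1 => /addIr.
Qed.

End CyclicRepresentations.

(** * Tensors as matrices *)

Section MatrixTensors.

Variable K : fieldType.
Local Open Scope ring_scope.

Lemma mxvec_eq m n p (M N : 'M[K]_(m * n, p)) :
  (forall A, mxvec A *m M = mxvec A *m N) -> M = N.
Proof.
by move=> eqMN; apply/row_matrixP => k; rewrite !rowE -(vec_mxK (delta_mx 0 k)).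
Qed.

Lemma mxvec_delta_eq m n p (M N : 'M[K]_(m * n, p)) :
    (forall i j, mxvec (delta_mx i j) *m M = mxvec (delta_mx i j) *m N) ->
  M = N.
Proof.
move=> eqMN; apply/row_matrixP; case/mxvec_indexP=> i j.
by rewrite !rowE -mxvec_delta.
Qed.

Lemma mxvec_sub m n p q (M : 'M[K]_(m * n, q)) (N : 'M[K]_(p, q)) :
  (forall A, (mxvec A *m M <= N)%MS) -> (M <= N)%MS.
Proof.
by move=> subMN; apply/row_subP => k; rewrite rowE -(vec_mxK (delta_mx 0 k)).
Qed.

(** The tensor product of two maps: v (x) w is the matrix v^T w, sent to (v P)^T (w Q). *)
Definition tens_mx m n p r (P : 'M[K]_(m, n)) (Q : 'M[K]_(p, r)) :
    'M_(m * p, n * r) :=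
  lin_mx (mulmxr Q \o mulmx P^T).

Lemma mul_tens_mx m n p r (P : 'M[K]_(m, n)) (Q : 'M[K]_(p, r)) A :
  mxvec A *m tens_mx P Q = mxvec (P^T *m A *m Q).
Proof. by rewrite mul_vec_lin. Qed.

Lemma tens_mxM m n p r s t (P : 'M[K]_(m, n)) (Q : 'M[K]_(p, r))
    (P' : 'M_(n, s)) (Q' : 'M_(r, t)) :
  tens_mx P Q *m tens_mx P' Q' = tens_mx (P *m P') (Q *m Q').
Proof.
by apply: mxvec_eq => A; rewrite mulmxA !mul_tens_mx trmx_mul !mulmxA.
Qed.

Lemma tens_mx1 m n : tens_mx (1%:M : 'M[K]_m) (1%:M : 'M_n) = 1%:M.
Proof.
by apply: mxvec_eq => A; rewrite mul_tens_mx trmx1 mul1mx !mulmx1.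
Qed.

(** This serves both squares: its image gives the relations of S^2 ([alt_mx_sym_rel]), its kernel
    those of wedge^2 ([ker_alt_mx_alt_rel]). *)
Definition alt_mx n : 'M[K]_(n * n) := 1%:M - lin_mx (@trmx K n n).

Lemma mul_alt_mx n (A : 'M[K]_n) : mxvec A *m alt_mx n = mxvec (A - A^T).
Proof. by rewrite mulmxBr mulmx1 mul_vec_lin linearB. Qed.

Lemma alt_mx_tens m n (P : 'M[K]_(m, n)) :
  alt_mx m *m tens_mx P P = tens_mx P P *m alt_mx n.
Proof.
apply: mxvec_eq => A; rewrite !mulmxA mul_alt_mx !mul_tens_mx mul_alt_mx.
by rewrite mulmxBr mulmxBl !trmx_mul trmxK mulmxA.
Qed.

Local Notation e i := (delta_mx 0 i : 'rV[K]__).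

(** The change of coordinates from [mxvec] to [trow], in which [prod_repr] acts. *)
Definition trow_mx n : 'M[K]_(n * n) :=
  \sum_(i < n) \sum_(j < n) (mxvec (delta_mx i j))^T *m trow (e i) (e j).

Lemma mul_trow_mx n (A : 'M[K]_n) :
  mxvec A *m trow_mx n =
    \sum_(i < n) \sum_(j < n) A i j *: trow (e i) (e j).
Proof.
rewrite mulmx_sumr; apply: eq_bigr => i _; rewrite mulmx_sumr.
apply: eq_bigr => j _; rewrite mulmxA -mul_scalar_mx; congr (_ *m _).
apply/matrixP => a b; rewrite !ord1 mxvec_delta trmx_delta -colE [LHS]mxE.
by rewrite mxvecE mxE mulr1n.
Qed.

Lemma mul_trow_mx_trow n (v w : 'rV[K]_n) :
  mxvec (v^T *m w) *m trow_mx n = trow v w.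
Proof.
rewrite mul_trow_mx trow_delta; apply: eq_bigr => i _; apply: eq_bigr => j _.
by congr (_ *: _); rewrite mxE big_ord1 mxE.
Qed.

Lemma trow_mx_tprod n (P Q : 'M[K]_n) :
  tens_mx P Q *m trow_mx n = trow_mx n *m tprod P Q.
Proof.
apply: mxvec_delta_eq => i j; rewrite !mulmxA mul_tens_mx.
have -> : delta_mx i j = (e i)^T *m e j :> 'M[K]_n.
  by rewrite trmx_delta mul_delta_mx.
by rewrite mul_trow_mx_trow trow_tprod -mul_trow_mx_trow trmx_mul !mulmxA.
Qed.

Lemma trow_span n1 n2 (w : 'rV[K]_(n1 * n2)) :
  exists W : 'M_(n1, n2), w = \sum_(i < n1) trow (e i) (row i W).
Proof.
elim: n1 w => [|n1 IHn] w; first by exists 0; rewrite big_ord0 [w]thinmx0.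
have [W defw] := IHn (rsubmx (w : 'rV_(n2 + n1 * n2))).
set a := lsubmx (w : 'rV_(n2 + n1 * n2)).
pose W' : 'M_(n1.+1, n2) :=
  \matrix_(i, j) if unlift ord0 i is Some k then W k j else a 0 j.
exists W'; rewrite big_ord_recl.
have -> : row ord0 W' = a by apply/rowP => j; rewrite !mxE unlift_none.
have rowW i : row (lift ord0 i) W' = row i W.
  by apply/rowP => j; rewrite !mxE liftK.
rewrite (eq_bigr (fun i => row_mx 0 (trow (e i) (row i W)))) => [|i _].
  rewrite -[LHS](hsubmxK (w : 'rV_(n2 + n1 * n2))) -/a defw /=.
  have -> : rsubmx (e ord0 : 'rV_(1 + n1)) = 0.
    by apply/rowP => j; rewrite !mxE.
  rewrite trow0 !mxE eqxx scale1r.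
  rewrite (_ : \sum_i _ = row_mx 0 (\sum_i trow (e i) (row i W))).
    by rewrite add_row_mx addr0 add0r.
  elim/big_rec2: _ => [|i u y _ ->]; first by rewrite row_mx0.
  by rewrite add_row_mx addr0.
rewrite rowW /=; congr row_mx.
  by rewrite !mxE -val_eqE /= scale0r.
have -> // : rsubmx (e (lift ord0 i) : 'rV_(1 + n1)) = e i.
by apply/rowP => j; rewrite !mxE -!val_eqE.
Qed.

Lemma trow_mx_unit n : trow_mx n \in unitmx.
Proof.
rewrite -row_full_unit -sub1mx; apply/row_subP => k.
have [W ->] := trow_span (row k 1%:M); apply: summx_sub => i _.
by rewrite -mul_trow_mx_trow submxMl.
Qed.

Lemma alt_mx_sym_rel n : (alt_mx n *m trow_mx n :=: sym_rel K n)%MS.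
Proof.
apply/eqmxP/andP; split.
  apply: mxvec_sub => A; rewrite mulmxA mul_alt_mx linearB mulmxBl !mul_trow_mx.
  rewrite [X in _ - X]exchange_big -sumrB summx_sub // => i _.
  rewrite -sumrB summx_sub // => j _; rewrite mxE -scalerBr scalemx_sub //.
  by have /sym_relP := submx_refl (sym_rel K n); apply.
apply/sym_relP => v w; apply/submxP; exists (mxvec (v^T *m w)).
rewrite mulmxA mul_alt_mx linearB mulmxBl trmx_mul trmxK.
by rewrite !mul_trow_mx_trow.
Qed.

(** The kernel consists of the symmetric matrices. Such a matrix is D + N + N^T with D diagonal and
    N strictly upper triangular, a combination of the e_i (x) e_i and the e_i (x) e_j + e_j (x)
    e_i. *)
Lemma ker_alt_mx_alt_rel n :
  2 \in [pchar K] -> (kermx (alt_mx n) *m trow_mx n :=: alt_rel K n)%MS.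
Proof.
move=> pK.
apply/eqmxP/andP; split; last first.
  apply/alt_relP => v; rewrite -mul_trow_mx_trow submxMr // sub_kermx.
  by rewrite mul_alt_mx trmx_mul trmxK subrr linear0.
apply/row_subP => k; rewrite row_mul -(vec_mxK (row k _)).
have : row k (kermx (alt_mx n)) *m alt_mx n = 0.
  by rewrite -row_mul mulmx_ker row0.
rewrite -{1}(vec_mxK (row k _)) mul_alt_mx; move: (vec_mx _) => A symA.
have {}symA i j : A i j = A j i.
  apply/eqP; rewrite -subr_eq0; apply/eqP.
  have := congr1 vec_mx symA; rewrite mxvecK linear0 => /matrixP/(_ i j).
  by rewrite !mxE.
have altP (v : 'rV_n) : (trow v v <= alt_rel K n)%MS.
  by have /alt_relP := submx_refl (alt_rel K n); apply.
have altS i j : ((trow (e i) (e j) + trow (e j) (e i))%R <= alt_rel K n)%MS.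
  rewrite -genmxE; apply: (sumsmx_sup i) => //.
  apply: submx_trans (addsmxSr _ _); exact: (sumsmx_sup j).
pose D : 'M_n := \matrix_(i, j) (A i j *+ (i == j)).
pose N : 'M_n := \matrix_(i, j) (A i j *+ (i < j)%N).
have -> : A = D + (N + N^T).
  apply/matrixP => i j; rewrite !mxE -val_eqE (symA j i).
  by case: ltngtP; rewrite ?mulr1n ?mulr0n ?addr0 ?add0r.
rewrite linearD mulmxDl; apply: addmx_sub.
  rewrite mul_trow_mx; apply: summx_sub => i _; apply: summx_sub => j _.
  rewrite mxE; have [<-|_] := eqVneq i j; first exact: scalemx_sub.
  by rewrite scale0r sub0mx.
rewrite linearD mulmxDl !mul_trow_mx.
have -> : \sum_i \sum_j N^T i j *: trow (e i) (e j) =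
          \sum_i \sum_j N i j *: trow (e j) (e i).
  rewrite exchange_big; apply: eq_bigr => i _; apply: eq_bigr => j _.
  by rewrite [N^T _ _]mxE.
rewrite -big_split summx_sub // => i _; rewrite -big_split summx_sub //= => j _.
by rewrite -scalerDr scalemx_sub.
Qed.

End MatrixTensors.

(** * The two squares in matrix coordinates *)

Section Squares.

Variables (K : fieldType) (gT : finGroupType) (x : gT).
Variable W : representation K <[x]>.
Local Open Scope ring_scope.
Local Notation n := (rdegree W).
Local Notation T := (tens_mx (W x) (W x)).

Lemma sym_square_proj : exists p : 'M_(n * n, rdegree (sym_square W)),
  [/\ row_full p, T *m p = p *m sym_square W x & (kermx p :=: alt_mx K n)%MS].
Proof.
have [p [fullp kerp homp]] := factmod_proj (sym_rel_mxmodule W).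
have unitB := trow_mx_unit K n.
exists (trow_mx K n *m p); split.
- by rewrite /row_full (eqmxMfull p) // row_full_unit.
- by rewrite mulmxA trow_mx_tprod -!mulmxA -(homp x) ?cycle_id.
have kerE m (A : 'M_(m, n * n)) :
    (A <= kermx (trow_mx K n *m p))%MS = (A <= alt_mx K n)%MS.
  rewrite sub_kermx mulmxA kerp -(alt_mx_sym_rel K n) submxMfree //.
  by rewrite row_free_unit.
by apply/eqmxP/andP; split; [rewrite -kerE | rewrite kerE].
Qed.

Lemma unip_rank_ext_square k : 2 \in [pchar K] ->
  unip_rank (ext_square W) k = \rank ((T - 1) ^+ k *m alt_mx K n).
Proof.
move=> pK.
have [p [fullp kerp homp]] := factmod_proj (alt_rel_mxmodule W).
have unitB := trow_mx_unit K n.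
have homBp : (T - 1) *m (trow_mx K n *m p) =
             trow_mx K n *m p *m (ext_square W x - 1).
  rewrite mulmxBl mulmxBr mulmx1 mul1mx mulmxA trow_mx_tprod -!mulmxA.
  by rewrite -(homp x) ?cycle_id.
have fullBp : row_full (trow_mx K n *m p).
  by rewrite /row_full (eqmxMfull p) // row_full_unit.
rewrite /unip_rank -(eqmxMfull _ fullBp) -(intertwine_exp k homBp).
(* The projection to the exterior square and [alt_mx] have the same kernel, so they lower the rank
   of [(T - 1) ^+ k] equally. *)
apply: (@addIn (\rank ((T - 1) ^+ k :&: kermx (alt_mx K n))%MS)).
rewrite mxrank_mul_ker.
have kerE m (A : 'M_(m, n * n)) :
    (A <= kermx (trow_mx K n *m p))%MS = (A <= kermx (alt_mx K n))%MS.
  rewrite sub_kermx mulmxA kerp -(ker_alt_mx_alt_rel n pK) submxMfree //.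
  by rewrite row_free_unit.
rewrite -[RHS](mxrank_mul_ker _ (trow_mx K n *m p)); congr (_ + _)%N.
apply/eqP; rewrite eqn_leq !mxrankS // sub_capmx capmxSl /= ?kerE ?capmxSr //.
by rewrite -kerE capmxSr.
Qed.

End Squares.

(** * The regular module and its tensor square *)

Section Rotation.

Variables (K : fieldType) (q' : nat).
Local Notation q := q'.+2.
Local Open Scope ring_scope.

(** [rot_mx 1] is the regular representation, a model of V_q in which the generator permutes a
    basis; writing [q] as [q'.+2] makes ['I_q] the ring Z/q. *)
Definition rot_mx (a : 'I_q) : 'M[K]_q := \matrix_(i, j) (j == i + a)%:R.

Lemma mul_rot_mx n (A : 'M[K]_(q, n)) a i j : (rot_mx a *m A) i j = A (i + a) j.
Proof.
rewrite mxE (bigD1 (i + a)) //= big1 => [|l ne_l].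
  by rewrite mxE eqxx mul1r addr0.
by rewrite mxE (negPf ne_l) mul0r.
Qed.

Lemma mul_mx_rot n (A : 'M[K]_(n, q)) a i j : (A *m rot_mx a) i j = A i (j - a).
Proof.
rewrite mxE (bigD1 (j - a)) //= big1 => [|l ne_l].
  by rewrite mxE subrK eqxx mulr1 addr0.
by rewrite mxE -subr_eq eq_sym (negPf ne_l) mulr0.
Qed.

Lemma tr_rot_mx a : (rot_mx a)^T = rot_mx (- a).
Proof. by apply/matrixP => i j; rewrite !mxE -subr_eq eq_sym. Qed.

Lemma mul_rot_rot (A : 'M[K]_q) a b i j :
  ((rot_mx a)^T *m A *m rot_mx b) i j = A (i - a) (j - b).
Proof. by rewrite mul_mx_rot tr_rot_mx mul_rot_mx. Qed.

Lemma rot_mx_exp k : rot_mx 1 ^+ k = rot_mx k%:R.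
Proof.
elim: k => [|k IHk]; first by apply/matrixP => i j; rewrite !mxE addr0 eq_sym.
rewrite expmxS IHk; apply/matrixP => i j.
by rewrite mul_rot_mx !mxE -addrA -natr1 [1 + _]addrC.
Qed.

Definition rot_nil : 'M[K]_q := rot_mx 1 - 1.

Hypothesis q_pow : exists2 a, 2 \in [pchar K] & q = (2 ^ a)%N.

Lemma rot_mx_exp_q : rot_mx 1 ^+ q = 1.
Proof.
rewrite rot_mx_exp; have -> : q%:R = 0 :> 'I_q by apply: (@pchar_Zp q).
by apply/matrixP => i j; rewrite !mxE addr0 eq_sym.
Qed.

Lemma rot_nil_exp : rot_nil ^+ q = 0.
Proof.
have [a pK eq_q] := q_pow.
have := exp_pchar_sub1 a (rot_mx 1) pK; rewrite -eq_q => ->.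
by rewrite rot_mx_exp_q subrr.
Qed.

(** Vectors fixed by the rotation are constant, so the kernel is a line and [nilp_free_rank] applies
    with [c = 1]. *)
Lemma rank_rot_nil k : \rank (rot_nil ^+ k) = (q - k)%N.
Proof.
rewrite (nilp_free_rank (c := 1) _ _ rot_nil_exp) ?muln1 //.
apply: (@rank_ker_leq _ _ _ 1 _ (const_mx 1)) => v /eqP.
rewrite mulmxBr mulmx1 subr_eq0 => /eqP vC.
have v0 k' : v 0 k'%:R = v 0 0.
  by elim: k' => // k' <-; rewrite -{1}vC mul_mx_rot -natr1 addrK.
apply/submxP; exists (v 0 0)%:M; rewrite mul_scalar_mx; apply/rowP => i.
by rewrite !mxE mulr1 -(v0 i) natr_Zp.
Qed.

Definition pull_entries m n r s (c : 'I_r -> 'I_s -> K)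
    (f : 'I_r -> 'I_s -> 'I_m) (g : 'I_r -> 'I_s -> 'I_n)
    (A : 'M[K]_(m, n)) : 'M[K]_(r, s) :=
  \matrix_(i, j) (c i j * A (f i j) (g i j)).

Lemma pull_entries_is_linear m n r s c f g :
  linear (@pull_entries m n r s c f g).
Proof.
move=> a A B; apply/matrixP => i j.
by rewrite !mxE mulrDr !mulrA [c _ _ * a]mulrC.
Qed.

HB.instance Definition _ m n r s c f g :=
  GRing.isSemilinear.Build _ _ _ _ (@pull_entries m n r s c f g)
    (GRing.semilinear_linear (@pull_entries_is_linear m n r s c f g)).

Definition pull_mx m n r s c f g := lin_mx (@pull_entries m n r s c f g).

Lemma mul_pull_mx m n r s c f g A :
  mxvec A *m @pull_mx m n r s c f g = mxvec (pull_entries c f g A).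
Proof. exact: mul_vec_lin. Qed.

(** The offset j - i is lowered by one so that the diagonal comes last, at d = q - 1, and the
    offsets from 1 to h - 1 form the initial segment d < h - 1. *)
Definition band_mx (c : pred 'I_q) : 'M[K]_(q * q) :=
  pull_mx (fun i j => (c (j - i - 1))%:R) (fun i j => i) (fun i j => j).

(* In the coordinates A'(d, i) = A(i, i + d + 1) the simultaneous rotation of *)
(* both indices acts on the second index only.                                *)
Definition untwist_mx : 'M[K]_(q * q) :=
  pull_mx (fun _ _ => 1) (fun d i => i) (fun d i => i + d + 1).

Definition twist_mx : 'M[K]_(q * q) :=
  pull_mx (fun _ _ => 1) (fun i j => j - i - 1) (fun i j => i).

Definition rot2_nil : 'M[K]_(q * q) := tens_mx (rot_mx 1) (rot_mx 1) - 1%:M.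

Lemma untwistK : untwist_mx *m twist_mx = 1%:M.
Proof.
apply: mxvec_eq => A; rewrite mulmxA !mul_pull_mx mulmx1; congr mxvec.
by apply/matrixP => i j; rewrite !mxE !mul1r addrA subrK addrC subrK.
Qed.

Lemma untwist_free : row_free untwist_mx.
Proof. by apply/row_freeP; exists twist_mx; apply: untwistK. Qed.

(** The tensor square of the regular module is free, with one regular summand for each offset. *)
Lemma rot2_nil_untwist k :
  rot2_nil ^+ k *m untwist_mx = untwist_mx *m tens_mx 1%:M (rot_nil ^+ k).
Proof.
have H : rot2_nil *m untwist_mx = untwist_mx *m tens_mx 1%:M rot_nil.
  apply: mxvec_eq => A; rewrite !mulmxA mulmxBr mulmx1 mul_tens_mx mulmxBl.
  rewrite !mul_pull_mx mul_tens_mx -linearB; congr mxvec.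
  rewrite trmx1 mul1mx mulmxBr mulmx1; congr (_ - _); apply/matrixP => d i.
  rewrite mul_mx_rot [LHS]mxE [RHS]mxE !mul1r mul_rot_rot.
  by congr (A _ _); rewrite addrK [RHS]addrAC subrK addrC.
rewrite (intertwine_exp k H); congr (_ *m _).
elim: k => [|k IHk]; first by rewrite !expr0 tens_mx1.
by rewrite !expmxS IHk tens_mxM mul1mx.
Qed.

Lemma rank_tens_mx m n r s (P : 'M[K]_(m, n)) (Q : 'M_(r, s)) :
  \rank (tens_mx P Q) = (\rank P * \rank Q)%N.
Proof.
rewrite -{1}(mulmx_base P) -{1}(mulmx_base Q) -tens_mxM.
have /row_freeP [P' PP'] := row_base_free P.
have /row_freeP [Q' QQ'] := row_base_free Q.
rewrite mxrankMfree; last first.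
  by apply/row_freeP; exists (tens_mx P' Q'); rewrite tens_mxM PP' QQ' tens_mx1.
have /row_fullP [P1 PP1] := col_base_full P.
have /row_fullP [Q1 QQ1] := col_base_full Q.
apply/eqP; rewrite -/(row_full _); apply/row_fullP.
by exists (tens_mx P1 Q1); rewrite tens_mxM PP1 QQ1 tens_mx1.
Qed.

Lemma band_untwist c :
  band_mx c *m untwist_mx =
    untwist_mx *m tens_mx (diag_mx (\row_d (c d)%:R)) 1%:M.
Proof.
apply: mxvec_eq => A; rewrite !mulmxA !mul_pull_mx mul_tens_mx mulmx1.
congr mxvec; rewrite tr_diag_mx; apply/matrixP => d i.
rewrite mul_diag_mx !mxE !mul1r; congr ((c _)%:R * _).
by rewrite -(addrA i) [i + _]addrC !addrK.
Qed.

Lemma rank_band c k :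
  \rank (band_mx c *m rot2_nil ^+ k) =
    (\rank (diag_mx (\row_d (c d)%:R : 'rV[K]_q)) * (q - k))%N.
Proof.
rewrite -(mxrankMfree _ untwist_free) -mulmxA rot2_nil_untwist mulmxA.
rewrite band_untwist -mulmxA tens_mxM mulmx1 mul1mx.
rewrite (eqmxMfull (tens_mx _ _)); first by rewrite rank_tens_mx rank_rot_nil.
by rewrite row_full_unit -row_free_unit untwist_free.
Qed.

End Rotation.

(** * The exterior square of the regular module *)

Section AlternatingRanks.

Variables (K : fieldType) (q' b h : nat).
Local Notation q := q'.+2.
Local Open Scope ring_scope.

Hypothesis charK : 2 \in [pchar K].
Hypothesis def_h : h = (2 ^ b)%N.
Hypothesis def_q : q = (h + h)%N.

Local Notation R := (alt_mx K q).
Local Notation T := (rot2_nil K q').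
Local Notation N := (rot_nil K q').

Let h_gt0 : (0 < h)%N. Proof. by rewrite def_h expn_gt0. Qed.

Let q_pow : exists2 a, 2 \in [pchar K] & q = (2 ^ a)%N.
Proof. by exists b.+1; rewrite // expnS -def_h mul2n -addnn. Qed.

Let half_add_half : h%:R + h%:R = 0 :> 'I_q.
Proof. by rewrite -natrD -def_q; apply: (@pchar_Zp q). Qed.

Lemma val_offset (i j : 'I_q) :
  (j - i - 1)%R = (if i < j then j - i - 1 else j + q - i - 1)%N :> nat.
Proof.
set r := (if _ then _ else _)%N.
have lt_ir := ltn_ord i; have lt_jr := ltn_ord j.
have lt_r : (r < q)%N by rewrite /r; case: ifP; lia.
suff -> : j - i - 1 = r%:R by rewrite Zp_nat /= modn_small.
have -> : j - i - 1 = j - i.+1%:R by rewrite -natr1 natr_Zp opprD addrA.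
apply/eqP; rewrite subr_eq -natrD /r -{1}(natr_Zp j).
case: ifP => lt_ij; first by apply/eqP; congr (_%:R); lia.
have q0 : q%:R = 0 :> 'I_q by apply: (@pchar_Zp q).
by apply/eqP; rewrite -[LHS]addr0 -q0 -natrD; congr (_%:R); lia.
Qed.

Definition near_half (i j : 'I_q) := ((j - i - 1)%R < h.-1)%N.
Definition at_half (i j : 'I_q) := (j - i - 1)%R == h.-1 :> nat.

Lemma near_half_asym i j : near_half i j -> near_half j i = false.
Proof.
rewrite /near_half !val_offset.
by case: (ltngtP i j) (ltn_ord i) (ltn_ord j); lia.
Qed.

Lemma at_half_sym i j : at_half i j = at_half j i.
Proof.
rewrite /at_half !val_offset.
by case: (ltngtP i j) (ltn_ord i) (ltn_ord j); lia.
Qed.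

Lemma at_half_near i j : at_half i j -> near_half i j = false.
Proof. by rewrite /near_half => /eqP ->; rewrite ltnn. Qed.

Lemma half_cases i j : i != j ->
  [\/ [/\ near_half i j, near_half j i = false & at_half i j = false],
      [/\ near_half i j = false, near_half j i & at_half i j = false]
    | [/\ near_half i j = false, near_half j i = false & at_half i j]].
Proof.
move=> ne_ij; have a_ji := at_half_sym i j.
have cover : [|| near_half i j, near_half j i | at_half i j].
  move: ne_ij; rewrite -val_eqE /at_half /near_half !val_offset /=.
  by case: (ltngtP i j) (ltn_ord i) (ltn_ord j); lia.
have [n_ij | nn_ij] := boolP (near_half i j).
  apply: Or31; split; rewrite ?(near_half_asym n_ij) //.
  by apply: contraTF n_ij => /at_half_near ->.
move: cover; rewrite (negPf nn_ij) /=.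
have [n_ji _ | nn_ji /= a_ij] := boolP (near_half j i).
  apply: Or32; split=> //; rewrite a_ji.
  by apply: contraTF n_ji => /at_half_near ->.
exact: Or33.
Qed.

Lemma at_halfE i j : at_half i j = (j == i + h%:R).
Proof.
have -> : at_half i j = (j - i - 1 == h.-1%:R).
  rewrite /at_half Zp_nat -[in RHS]val_eqE [X in _ = (_ == X)]/= modn_small //.
  by have := h_gt0; lia.
by rewrite subr_eq natr1 prednK // subr_eq addrC.
Qed.

Local Notation E := (band_mx K (fun d : 'I_q => d < h.-1)%N).
Local Notation F := (band_mx K (fun d : 'I_q => d == h.-1 :> nat)).

Lemma mul_bandE c A :
  mxvec A *m band_mx K c =
    mxvec (\matrix_(i, j) ((c (j - i - 1))%:R * A i j) : 'M_q).
Proof. exact: mul_pull_mx. Qed.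

Lemma band_rot2 c k : band_mx K c *m T ^+ k = T ^+ k *m band_mx K c.
Proof.
apply/esym/intertwine_exp; apply: mxvec_eq => A; rewrite !mulmxA.
rewrite mul_bandE [X in X *m _]mulmxBr [RHS]mulmxBr mulmxBl !mulmx1 mul_bandE.
congr (_ - _); rewrite !mul_tens_mx mul_bandE; congr mxvec.
apply/matrixP => i j; rewrite [LHS]mxE !mul_rot_rot [RHS]mxE.
congr ((c _)%:R * _).
by rewrite opprB addrACA [- _ + _]addrC -addrACA subrr addr0.
Qed.

Lemma alt_rot2 k : R *m T ^+ k = T ^+ k *m R.
Proof.
apply/esym/intertwine_exp.
by rewrite [LHS]mulmxBl [RHS]mulmxBr mul1mx mulmx1 alt_mx_tens.
Qed.

(** Transposition turns offset d into q - d, so it moves the offsets 1, ..., h - 1 off themselves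
    and [E] recovers [A] from A - A^T. *)
Lemma band_alt_band : E *m R *m E = E.
Proof.
apply: mxvec_eq => A; rewrite !mulmxA mul_bandE mul_alt_mx mul_bandE.
congr mxvec; apply/matrixP => i j; rewrite !mxE -!/(near_half _ _).
have [/near_half_asym ->|_] := boolP (near_half i j); last by rewrite !mul0r.
by rewrite !mul1r mul0r subr0.
Qed.

Lemma band_alt_half : E *m R *m F = 0.
Proof.
apply: mxvec_eq => A; rewrite !mulmxA mul_bandE mul_alt_mx mul_bandE mulmx0.
rewrite -[RHS](linear0 mxvec); congr mxvec; apply/matrixP => i j.
rewrite !mxE -!/(near_half _ _) -!/(at_half _ _).
have [f_ij|_] := boolP (at_half i j); last by rewrite mul0r.
have f_ji : at_half j i by rewrite at_half_sym.
by rewrite (at_half_near f_ij) (at_half_near f_ji) !mul0r subrr mulr0.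
Qed.

(** An alternating matrix is its band at offsets below h, antisymmetrized, plus its entries at
    offset h. *)
Lemma alt_decomp : R = R *m E *m R + R *m F.
Proof.
apply: mxvec_eq => A; rewrite mulmxDr !mulmxA mul_alt_mx !mul_bandE mul_alt_mx.
rewrite -linearD; congr mxvec; apply/matrixP => i j.
have [-> | ne_ij] := eqVneq i j; first by rewrite !mxE !subrr !mulr0 addr0.
rewrite !mxE -!/(near_half _ _) -!/(at_half _ _).
have [[-> -> ->] | [-> -> ->] | [-> -> ->]] := half_cases ne_ij.
- by rewrite mul1r !mul0r subr0 addr0.
- by rewrite mul1r !mul0r sub0r opprB addr0.
- by rewrite mul1r !mul0r subr0 add0r.
Qed.

(** As 2h = 0 in Z/q, swapping i and i + h is adding h to both, so transposition at offset h is the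
    action of g^h. By Frobenius [T ^+ h] is g^h - 1. *)
Lemma half_alt : F *m R = - (F *m T ^+ h).
Proof.
have -> : T ^+ h = tens_mx (rot_mx K h%:R) (rot_mx K h%:R) - 1%:M.
  have := exp_pchar_sub1 b (tens_mx (rot_mx K 1) (rot_mx K 1 : 'M_q)) charK.
  rewrite -def_h => ->; rewrite -!rot_mx_exp; congr (_ - _).
  elim: (h) => [|k IHk]; first by rewrite !expr0 tens_mx1.
  by rewrite !expmxS IHk tens_mxM.
apply: mxvec_eq => A.
rewrite mulmxN !mulmxA mul_bandE mul_alt_mx mulmxBr mulmx1 mul_tens_mx.
rewrite opprB -linearB; congr (mxvec (_ - _)).
apply/matrixP => i j; rewrite mul_rot_rot [LHS]mxE [LHS]mxE [RHS]mxE.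
rewrite -!/(at_half _ _).
have -> : at_half (i - h%:R) (j - h%:R) = at_half j i.
  by rewrite [RHS]at_half_sym !at_halfE subrK subr_eq.
have [|_] := boolP (at_half j i); last by rewrite !mul0r.
rewrite at_half_sym at_halfE => /eqP ->; rewrite addrK !mul1r.
by congr (A _ _); rewrite -[in RHS](addr0 i) -half_add_half addrA addrK.
Qed.

Lemma band_mxK c : band_mx K c *m band_mx K c = band_mx K c :> 'M_(q * q).
Proof.
apply: mxvec_eq => A; rewrite mulmxA !mul_bandE; congr mxvec.
by apply/matrixP => i j; rewrite !mxE mulrA -natrM mulnb andbb.
Qed.

Lemma half_alt_comm : F *m R = R *m F.
Proof.
apply: mxvec_eq => A; rewrite !mulmxA mul_bandE !mul_alt_mx mul_bandE.
congr mxvec; apply/matrixP => i j; rewrite !mxE -!/(at_half _ _).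
by rewrite (at_half_sym j) mulrBr.
Qed.

Lemma rank_near_half k : \rank (E *m T ^+ k) = (h.-1 * (q - k))%N.
Proof.
rewrite rank_band //; congr (_ * _)%N.
have -> : diag_mx (\row_(d < q) (d < h.-1)%:R) = pid_mx h.-1 :> 'M[K]_q.
  by apply/matrixP => i j; rewrite !mxE -mulrnA mulnb andbC.
by rewrite rank_pid_mx // ; have := h_gt0; lia.
Qed.

Lemma rank_at_half k : \rank (F *m T ^+ k) = (q - k)%N.
Proof.
rewrite rank_band //; have lt_h : (h.-1 < q)%N by have := h_gt0; lia.
have -> : diag_mx (\row_(d < q) (d == h.-1 :> nat)%:R) =
          delta_mx (Ordinal lt_h) (Ordinal lt_h) :> 'M[K]_q.
  apply/matrixP => i j; rewrite !mxE -!val_eqE /= -mulrnA mulnb.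
  by case: eqP => [->|] //=; rewrite eq_sym.
by rewrite mxrank_delta mul1n.
Qed.

(* On the part near_half, R is injective; on the part at_half, where          *)
(* transposition is the h-th power of the generator, R is T ^+ h.             *)
Lemma rank_alt_rot2 k : \rank (R *m T ^+ k) = (h.-1 * (q - k) + (h - k))%N.
Proof.
have eqRT : (R *m T ^+ k :=: E *m R *m T ^+ k + F *m R *m T ^+ k)%MS.
  apply/eqmxP/andP; split.
    rewrite {1}alt_decomp -half_alt_comm mulmxDl addmx_sub_adds //.
    by rewrite -!mulmxA submxMl.
  by rewrite addsmx_sub -!mulmxA !submxMl.
have EE : E *m T ^+ k = E *m R *m T ^+ k *m E.
  by rewrite -!(mulmxA _ (T ^+ k)) -band_rot2 !mulmxA band_alt_band.
have ERF : E *m R *m T ^+ k *m F = 0.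
  by rewrite -(mulmxA _ (T ^+ k)) -band_rot2 mulmxA band_alt_half mul0mx.
have FRF : F *m R *m T ^+ k *m F = F *m R *m T ^+ k.
  rewrite -!(mulmxA _ (T ^+ k)) -band_rot2 !mulmxA half_alt_comm.
  by rewrite -(mulmxA R) band_mxK.
rewrite eqRT mxrank_disjoint_sum; last first.
  apply/eqP; rewrite -submx0; apply/rV_subP => v; rewrite sub_capmx.
  case/andP => /submxP [a va] /submxP [b' vb].
  by rewrite submx0 vb -FRF mulmxA -vb va -mulmxA ERF mulmx0.
congr (_ + _)%N.
  apply/eqP; rewrite -rank_near_half eqn_leq {2}EE mxrankM_maxl andbT.
  by rewrite -mulmxA alt_rot2 mulmxA mxrankM_maxl.
rewrite half_alt mulNmx mxrank_opp -mulmxA -expmxD rank_at_half.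
by have := h_gt0; lia.
Qed.

(** The band is free, so on it the image of [T ^+ j] is the kernel of [T ^+ (q - j)]: one inclusion
    is clear and the dimensions agree. *)
Lemma near_half_exact r (Y : 'M[K]_(r, q * q)) j :
    (j <= q)%N -> (Y <= E)%MS -> Y *m T ^+ (q - j) = 0 ->
  (Y <= E *m T ^+ j)%MS.
Proof.
move=> le_jq sYE YT0; set k := (q - j)%N.
have subk : (E *m T ^+ j <= E :&: kermx (T ^+ k))%MS.
  rewrite sub_capmx; apply/andP; split; first by rewrite band_rot2 submxMl.
  rewrite sub_kermx -mulmxA -expmxD subnKC //; apply/eqP/eqP.
  by rewrite -mxrank_eq0 rank_near_half subnn muln0.
have rkE : \rank E = (h.-1 * q)%N.
  by have := rank_near_half 0; rewrite expr0 mulmx1 subn0.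
have [_ /esym] := mxrank_leqif_sup subk.
have -> : \rank (E *m T ^+ j) = \rank (E :&: kermx (T ^+ k))%MS.
  apply: (@addnI (\rank (E *m T ^+ k))); rewrite mxrank_mul_ker !rank_near_half.
  by rewrite rkE -mulnDr /k; congr (_ * _)%N; lia.
rewrite eqxx => subE; apply: submx_trans subE.
by rewrite sub_capmx sYE sub_kermx YT0 eqxx.
Qed.

(** With N^h = g^h - 1 and B alternating, the entry of (N^h)^T B N^h at (i, i + h) is B(i + h, i) -
    B(i + h, i + h) - B(i, i) + B(i, i + h) = 0. So the component at offset h, where the action is
    not free, is absent. *)
Lemma alt_tens_half :
  R *m tens_mx (N ^+ h) (N ^+ h) = R *m tens_mx (N ^+ h) (N ^+ h) *m E *m R.
Proof.
have NhE : N ^+ h = rot_mx K h%:R - 1%:M.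
  by rewrite /rot_nil def_h exp_pchar_sub1 // -def_h rot_mx_exp.
suff RF : R *m tens_mx (N ^+ h) (N ^+ h) *m F = 0.
  by rewrite alt_mx_tens {1}alt_decomp mulmxDr !mulmxA -alt_mx_tens RF addr0.
rewrite NhE; apply: mxvec_eq => A.
rewrite !mulmxA mul_alt_mx mul_tens_mx mul_bandE mulmx0 -[RHS](linear0 mxvec).
congr mxvec; apply/matrixP => i j; rewrite [LHS]mxE [RHS]mxE -!/(at_half _ _).
rewrite at_halfE; case: eqP => [-> | _]; last by rewrite mul0r.
have alt_ij k l : (A - A^T) k l = - (A - A^T) l k by rewrite !mxE opprB.
have alt_ii k : (A - A^T) k k = 0 by rewrite !mxE subrr.
move: (A - A^T) alt_ij alt_ii => B alt_ij alt_ii.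
have subh k : k - h%:R = k + h%:R :> 'I_q.
  by apply/eqP; rewrite subr_eq -addrA half_add_half addr0.
have subE (X Y : 'M[K]_q) k l : (X - Y) k l = X k l - Y k l by rewrite !mxE.
rewrite mul1r mulmxBr mulmx1 [_^T]linearB /= trmx1 !mulmxBl !mul1mx tr_rot_mx.
rewrite !subE !mul_mx_rot !mul_rot_mx addrK subh !alt_ii (alt_ij (i + _)).
by rewrite subr0 sub0r opprK addNr.
Qed.

(** Such tensors are recovered from their free band by [R], so the exactness of the band carries
    over to them. *)
Lemma alt_half_exact r (Z : 'M[K]_(r, q * q)) j :
    let Y := Z *m R *m tens_mx (N ^+ h) (N ^+ h) in
  (j <= q)%N -> Y *m T ^+ (q - j) = 0 -> (Y <= R *m T ^+ j)%MS.
Proof.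
move=> Y le_jq YT0.
have -> : Y = Y *m E *m R by rewrite /Y -!(mulmxA Z) {1}alt_tens_half !mulmxA.
apply: submx_trans (_ : E *m T ^+ j *m R <= _)%MS.
  apply: submxMr; apply: near_half_exact; rewrite ?submxMl //.
  by rewrite -mulmxA band_rot2 mulmxA YT0 mul0mx.
by rewrite -mulmxA -alt_rot2 submxMl.
Qed.

End AlternatingRanks.

(** * Exactness of the Koszul complex *)

Section Koszul.

Variables (K : fieldType) (m n q : nat).
Local Open Scope ring_scope.

Variables (pi : 'M[K]_(q, n)) (iota : 'M[K]_(m, q)).
Hypotheses (pi_full : row_full pi) (iota_free : row_free iota).
Hypothesis ker_pi : (kermx pi :=: iota)%MS.

Let iota_pi : iota *m pi = 0.
Proof. by apply/eqP; rewrite -sub_kermx ker_pi. Qed.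

(** If B is alternating and pi^T B = 0, the rows and columns of B all lie in the image of [iota];
    compressing B by a right inverse of [iota] gives the preimage. *)
Lemma koszul_exact_ext :
  (alt_mx K q :&: kermx (tens_mx pi 1%:M) :=:
     alt_mx K m *m tens_mx iota iota)%MS.
Proof.
apply/eqmxP/andP; split; last first.
  rewrite sub_capmx {1}alt_mx_tens submxMl sub_kermx -mulmxA tens_mxM iota_pi.
  apply/eqP; apply: mxvec_eq => A; rewrite !mulmxA mul_alt_mx mul_tens_mx.
  by rewrite trmx0 !mul0mx linear0 mulmx0.
apply/rV_subP => v; rewrite sub_capmx sub_kermx => /andP [/submxP [u ->]].
rewrite -(vec_mxK u) mul_alt_mx mul_tens_mx mulmx1; move: (vec_mx u) => A.
move/eqP/(congr1 vec_mx); rewrite mxvecK linear0 => piA.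
have altA : (A - A^T)^T = - (A - A^T) by rewrite linearB /= trmxK opprB.
have /submxP [Y defA] : (A - A^T <= iota)%MS.
  rewrite -ker_pi sub_kermx -oppr_eq0 -mulNmx -altA -[pi]trmxK.
  by rewrite -trmx_mul piA trmx0.
have /row_freeP [rho iotaK] := iota_free.
have defR : A - A^T = (A - A^T) *m rho *m iota.
  by rewrite {2}defA -(mulmxA Y) iotaK mulmx1.
have defL : A - A^T = iota^T *m rho^T *m (A - A^T).
  rewrite -[LHS]opprK -altA {1}defR !trmx_mul altA !mulmxN opprK.
  by rewrite mulmxA.
apply/submxP; exists (mxvec (rho^T *m A *m rho)).
rewrite mulmxA mul_alt_mx mul_tens_mx !trmx_mul trmxK (mulmxA rho^T).
rewrite -mulmxBl -mulmxBr.
by congr mxvec; rewrite {1}defR {1}defL !mulmxA.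
Qed.

Lemma koszul_exact_sym d (p : 'M[K]_(n * n, d)) : (kermx p :=: alt_mx K n)%MS ->
  (kermx (tens_mx 1%:M pi *m p) :=: alt_mx K q *m tens_mx pi 1%:M)%MS.
Proof.
move=> ker_p; apply/eqmxP/andP; split; last first.
  rewrite sub_kermx -mulmxA (mulmxA (tens_mx pi _)) tens_mxM mul1mx mulmx1.
  by rewrite mulmxA alt_mx_tens -sub_kermx ker_p submxMl.
apply/rV_subP => v; rewrite sub_kermx mulmxA -sub_kermx ker_p.
rewrite -(vec_mxK v) mul_tens_mx trmx1 mul1mx; move: (vec_mx v) => A.
case/submxP => u; rewrite -(vec_mxK u) mul_alt_mx; move: (vec_mx u) => D.
move/(congr1 vec_mx); rewrite !mxvecK => piA.
have /row_fullP [sigma sigmaK] := pi_full.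
(* [sigma] is a section of [pi], so [A'] is the part of [A] killed by [pi] on the right. *)
pose A' := A - (D - D^T) *m sigma.
have A'0 : pi^T *m A'^T = 0.
  by rewrite -trmx_mul mulmxBl -mulmxA sigmaK mulmx1 piA subrr trmx0.
have piT : pi^T *m sigma^T = 1%:M by rewrite -trmx_mul sigmaK trmx1.
(* The first term of [X] lifts D - D^T, the second restores [A']; the transpose of the second dies
   under [pi]. *)
pose X := sigma^T *m D *m sigma + sigma^T *m A'.
have XT : X^T = sigma^T *m D^T *m sigma + A'^T *m sigma.
  by rewrite /X linearD /= !trmx_mul !trmxK mulmxA.
apply/submxP; exists (mxvec X); rewrite mulmxA mul_alt_mx mul_tens_mx mulmx1.
congr mxvec; rewrite mulmxBr XT !mulmxDr !mulmxA piT !mul1mx A'0 mul0mx addr0.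
by rewrite addrAC -mulmxBl [RHS]addrC subrK.
Qed.

End Koszul.

(** * Tensoring with the regular module gives a free module *)

Section FreeTensor.

Variables (K : fieldType) (q' n : nat).
Local Notation q := q'.+2.
Local Open Scope ring_scope.

Hypothesis q_pow : exists2 a, 2 \in [pchar K] & q = (2 ^ a)%N.

Lemma tens_mx_exp r s (P : 'M[K]_r) (Q : 'M[K]_s) k :
  tens_mx P Q ^+ k = tens_mx (P ^+ k) (Q ^+ k).
Proof.
elim: k => [|k IHk]; first by rewrite !expr0 tens_mx1.
by rewrite !expmxS IHk tens_mxM.
Qed.

Lemma rank_tens_rot (J : 'M[K]_n) k : J ^+ q = 1 ->
  \rank ((tens_mx J (rot_mx K 1 : 'M_q) - 1%:M) ^+ k) = (n * (q - k))%N.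
Proof.
move=> Jq; rewrite [RHS]mulnC; apply: nilp_free_rank; first exact: mulnC.
  have [a pK eq_q] := q_pow.
  have := exp_pchar_sub1 a (tens_mx J (rot_mx K 1 : 'M_q)) pK.
  rewrite -eq_q => ->; rewrite tens_mx_exp Jq rot_mx_exp_q //.
  by rewrite tens_mx1 subrr.
set A := (A in kermx A).
(* A fixed tensor is determined by its column 0. *)
pose P : 'M[K]_(n * q, 1 * n) :=
  pull_mx (fun _ _ => 1) (fun _ l => l) (fun _ _ => 0).
suff KP0 : (kermx A :&: kermx P)%MS = 0.
  rewrite -(mxrank_mul_ker _ P) KP0 mxrank0 addn0 -[X in (_ <= X)%N]mul1n.
  exact: rank_leq_col.
apply/eqP; rewrite -submx0; apply/rV_subP => v; rewrite sub_capmx !sub_kermx.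
rewrite -(vec_mxK v); move: (vec_mx v) => B /andP [].
rewrite mulmxBr mulmx1 mul_tens_mx subr_eq0 => /eqP/(congr1 vec_mx).
rewrite !mxvecK mul_pull_mx => fixB /eqP/(congr1 vec_mx).
rewrite mxvecK linear0 => /matrixP B0; suff colB k' l : B l k'%:R = 0.
  rewrite submx0 (_ : B = 0) ?linear0 //; apply/matrixP => i j.
  by rewrite -(natr_Zp j) colB mxE.
elim: k' l => [|k' IHk] l; first by have := B0 0 l; rewrite !mxE mul1r.
rewrite -fixB mul_mx_rot -natr1 addrK mxE big1 // => i _.
by rewrite IHk mulr0.
Qed.

End FreeTensor.

(** * V_m and V_n as submodule and quotient of V_q *)

Section Assembly.

Variables (K : fieldType) (q' b h : nat).
Local Notation q := q'.+2.
Local Open Scope ring_scope.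

Hypothesis charK : 2 \in [pchar K].
Hypothesis def_h : h = (2 ^ b)%N.
Hypothesis def_q : q = (h + h)%N.

Let q_pow : exists2 a, 2 \in [pchar K] & q = (2 ^ a)%N.
Proof. by exists b.+1; rewrite // expnS -def_h mul2n -addnn. Qed.

Local Notation C := (rot_mx K (1 : 'I_q)).
Local Notation N := (rot_nil K q').
Local Notation R := (alt_mx K q).
Local Notation T := (rot2_nil K q').
Local Notation J := (jordan_block K).

Lemma jordan_block_exp_q n : (n <= q)%N -> J n ^+ q = 1.
Proof.
by have [a _ eq_q] := q_pow => le_nq; rewrite eq_q jordan_block_exp // -eq_q.
Qed.

Let Z := krylov_mx q (delta_mx 0 0 : 'rV[K]_q) N.

(** The row space of [Z] contains e_0 and is stable under [N], hence under C = 1 + N, whose powers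
    carry e_0 to every basis vector. So [Z] passes from the Jordan basis to the permuted one. *)
Lemma krylov_rot_unit : Z \in unitmx.
Proof.
have shiftZ : shift_mx K q *m Z = Z *m N.
  by rewrite krylov_shift // rot_nil_exp // mulmx0.
have e0Z : ((delta_mx 0 0 : 'rV_q) <= Z)%MS.
  have -> : delta_mx 0 0 = row 0 Z by rewrite rowK expr0 mulmx1.
  exact: row_sub.
rewrite -row_full_unit -sub1mx; apply/row_subP => i.
have -> : row i 1%:M = delta_mx 0 0 *m C ^+ i :> 'rV_q.
  rewrite rot_mx_exp natr_Zp; apply/rowP => j.
  by rewrite mul_mx_rot !mxE eqxx subr_eq0 eq_sym.
elim: (nat_of_ord i) => [|k IHk]; first by rewrite expr0 mulmx1.
rewrite expmxSr mulmxA -{2}[C](subrK 1) mulmxDr mulmx1 addmx_sub //.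
by apply: submx_trans (submxMr _ IHk) _; rewrite -/N -shiftZ submxMl.
Qed.

Lemma jordan_resolution m n : (m + n)%N = q -> (h <= n)%N ->
  exists (pi : 'M[K]_(q, n)) (iota iota' : 'M[K]_(m, q)),
    [/\ row_full pi, row_free iota & (kermx pi :=: iota)%MS] /\
    [/\ C *m pi = pi *m J n, J m *m iota = iota *m C & iota = iota' *m N ^+ h].
Proof.
move=> eq_mn le_hn; have unitZ := krylov_rot_unit.
have shiftZ : shift_mx K q *m Z = Z *m N.
  by rewrite krylov_shift // rot_nil_exp // mulmx0.
have CN : C = 1%:M + N by rewrite addrC subrK.
have JN i : J i = 1%:M + shift_mx K i by rewrite -jordan_block_sub1 addrC subrK.
have iota_free : row_free (jump_mx K m q n *m Z).
  rewrite /row_free mxrankMfree ?row_free_unit // -/(row_free _).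
  by rewrite jump_mx_free ?eq_mn.
have pi_full : row_full (invmx Z *m jump_mx K q n 0).
  rewrite /row_full (eqmxMfull (jump_mx K q n 0)) ?row_full_unit ?unitmx_inv //.
  by rewrite -/(row_full _) jump_mx_full //; lia.
exists (invmx Z *m jump_mx K q n 0), (jump_mx K m q n *m Z).
(* V_m is spanned by the last m vectors of the Jordan basis, from index n on; since h <= n they are
   N^h of the vectors from index n - h on. *)
exists (jump_mx K m q (n - h) *m Z).
split; split=> //.
- apply/eqmx_sym/eqmxP; rewrite -(geq_leqif (mxrank_leqif_eq _)).
    by rewrite mxrank_ker (eqP pi_full) (eqP iota_free); lia.
  rewrite sub_kermx mulmxA -(mulmxA (jump_mx K m q n)) mulmxV // mulmx1.
  by rewrite jump_mxM ?jump_mx_out ?leq_addr //; lia.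
- rewrite CN JN mulmxDl mulmxDr mul1mx mulmx1; congr (_ + _).
  have -> : N = invmx Z *m shift_mx K q *m Z by rewrite -mulmxA shiftZ mulKmx.
  rewrite !mulmxA mulmxK // -!mulmxA !jump_mxM ?addn0 ?leq_addr //; lia.
- rewrite CN JN mulmxDl mulmxDr mul1mx mulmx1; congr (_ + _).
  rewrite -mulmxA -shiftZ !mulmxA !jump_mxM ?leq_addr 1?addnC //; lia.
rewrite -mulmxA -(intertwine_exp h shiftZ) mulmxA jump_mx_exp.
by rewrite jump_mxM ?leq_addr // subnK.
Qed.

End Assembly.

(** * Ranks on the symmetric square *)

Section SymmetricSquareRank.

Variables (K : fieldType) (q' b h m n d : nat).
Local Notation q := q'.+2.
Local Open Scope ring_scope.

Hypothesis charK : 2 \in [pchar K].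
Hypothesis def_h : h = (2 ^ b)%N.
Hypothesis def_q : q = (h + h)%N.
Hypotheses (eq_mn : (m + n)%N = q) (le_hn : (h <= n)%N).

Local Notation C := (rot_mx K (1 : 'I_q)).
Local Notation R := (alt_mx K q).
Local Notation T := (rot2_nil K q').
Local Notation J := (jordan_block K).
Local Notation Tm := (tens_mx (J m) (J m) - 1).

Variables (S : 'M[K]_d) (p : 'M[K]_(n * n, d)).
Hypotheses (p_full : row_full p) (ker_p : (kermx p :=: alt_mx K n)%MS).
Hypothesis pS : tens_mx (J n) (J n) *m p = p *m S.

Let q_pow : exists2 a, 2 \in [pchar K] & q = (2 ^ a)%N.
Proof. by exists b.+1; rewrite // expnS -def_h mul2n -addnn. Qed.

Lemma tens_jordan_nilp k : (q <= k)%N -> Tm ^+ k = 0.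
Proof.
move=> le_qk; apply: (nilp_exp0 _ le_qk).
have [a _ eq_q] := q_pow; rewrite {1}eq_q exp_pchar_sub1 // -eq_q.
rewrite tens_mx_exp (jordan_block_exp_q charK def_h def_q) ?tens_mx1 ?subrr //.
by rewrite -eq_mn leq_addr.
Qed.

Lemma alt_tens_jordan k :
  alt_mx K m *m Tm ^+ k = Tm ^+ k *m alt_mx K m.
Proof.
apply/esym/intertwine_exp.
by rewrite [LHS]mulmxBl [RHS]mulmxBr mul1mx mulmx1 alt_mx_tens.
Qed.

Section Resolution.

Variables (pi : 'M[K]_(q, n)) (iota iota' : 'M[K]_(m, q)).
Hypotheses (pi_full : row_full pi) (iota_free : row_free iota).
Hypothesis ker_pi : (kermx pi :=: iota)%MS.
Hypotheses (C_pi : C *m pi = pi *m J n) (J_iota : J m *m iota = iota *m C).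
Hypothesis def_iota : iota = iota' *m rot_nil K q' ^+ h.

Local Notation phi := (tens_mx pi (1%:M : 'M_q)).
Local Notation U := (alt_mx K m *m tens_mx iota iota).

Lemma tens_mx_free r s t u (P : 'M[K]_(r, s)) (Q : 'M[K]_(t, u)) :
  row_free P -> row_free Q -> row_free (tens_mx P Q).
Proof. by move=> /eqP rP /eqP rQ; rewrite /row_free rank_tens_mx rP rQ. Qed.

Lemma rank_ext_rot2 k : \rank (U *m T ^+ k) = \rank (Tm ^+ k *m alt_mx K m).
Proof.
have homU : Tm *m tens_mx iota iota = tens_mx iota iota *m T.
  by rewrite mulmxBl mul1mx [RHS]mulmxBr mulmx1 !tens_mxM J_iota.
rewrite -mulmxA -(intertwine_exp k homU) mulmxA mxrankMfree ?tens_mx_free //.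
by rewrite alt_tens_jordan.
Qed.

(** From left to right, [T ^+ q = 0] suffices. The converse is [alt_half_exact], available because
    [iota] factors through [N ^+ h]. *)
Lemma cap_alt_ker k : (k <= q)%N ->
  (R *m T ^+ k :&: kermx phi :=: U :&: kermx (T ^+ (q - k)))%MS.
Proof.
move=> le_kq; have exactU := koszul_exact_ext iota_free ker_pi.
have Tq : T ^+ q = 0.
  have := tens_mx_exp C C q; rewrite rot_mx_exp_q // tens_mx1 => Cq.
  have [a _ eq_q] := q_pow; have := exp_pchar_sub1 a (tens_mx C C) charK.
  by rewrite -eq_q => ->; rewrite Cq subrr.
apply/eqmxP/andP; split.
  rewrite sub_capmx -exactU; apply/andP; split.
    by apply: capmxS => //; rewrite alt_rot2 submxMl.
  apply: submx_trans (capmxSl _ _) _; rewrite sub_kermx -mulmxA -expmxD.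
  by rewrite subnKC // Tq mulmx0.
rewrite sub_capmx; apply/andP; split; last first.
  by apply: submx_trans (capmxSl _ _) _; rewrite -exactU capmxSr.
apply/rV_subP => v; rewrite sub_capmx sub_kermx => /andP [/submxP [z ->]].
rewrite def_iota -tens_mxM (mulmxA (alt_mx K m)) alt_mx_tens !mulmxA => /eqP.
exact: (alt_half_exact charK def_h def_q).
Qed.

Lemma rank_alt_phi k : (k <= q)%N ->
  (\rank (R *m T ^+ k *m phi) + \rank (Tm ^+ 0 *m alt_mx K m) =
    h.-1 * (q - k) + (h - k) + \rank (Tm ^+ (q - k) *m alt_mx K m))%N.
Proof.
move=> le_kq; rewrite -(rank_alt_rot2 charK def_h def_q).
rewrite -(mxrank_mul_ker (R *m T ^+ k) phi) (cap_alt_ker le_kq) -!rank_ext_rot2.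
by rewrite expr0 mulmx1 -(mxrank_mul_ker U (T ^+ (q - k))) addnAC addnA.
Qed.

Lemma rank_sym_resolution k : (k <= q)%N ->
  \rank ((S - 1) ^+ k) =
    (\rank (Tm ^+ k *m alt_mx K m) + (n - h) * (q - k) + (h - k))%N.
Proof.
move=> le_kq; set j := (q - k)%N.
pose Tz := tens_mx (J n) C - 1%:M; pose f := tens_mx 1%:M pi *m p.
have f_full : row_full f.
  rewrite /row_full (eqmxMfull p) //.
  by rewrite /row_full rank_tens_mx mxrank1 (eqP pi_full).
have homf : Tz *m f = f *m (S - 1).
  rewrite mulmxBl mulmxBr mul1mx mulmx1 /f -(mulmxA _ p) -pS !mulmxA !tens_mxM.
  by rewrite mulmx1 mul1mx C_pi.
have hom_phi i : T ^+ i *m phi = phi *m Tz ^+ i.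
  apply: intertwine_exp; rewrite mulmxBl mul1mx [RHS]mulmxBr mulmx1 !tens_mxM.
  by rewrite C_pi mulmx1 mul1mx.
have rkTz i : \rank (Tz ^+ i) = (n * (q - i))%N.
  apply: (rank_tens_rot q_pow); apply: (jordan_block_exp_q charK def_h def_q).
  by rewrite -eq_mn leq_addl.
have kerTz : (Tz ^+ k :=: kermx (Tz ^+ j))%MS.
  apply/eqmxP; rewrite -(geq_leqif (mxrank_leqif_eq _)).
    by rewrite mxrank_ker !rkTz /j subKn // -mulnBr.
  by rewrite sub_kermx -expmxD subnKC // -mxrank_eq0 rkTz subnn muln0.
have ker_f := koszul_exact_sym pi_full ker_p.
have rank_f i : \rank (kermx f *m Tz ^+ i) = \rank (R *m T ^+ i *m phi).
  by rewrite (eqmxMr _ ker_f) -!mulmxA hom_phi.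
(* By freeness the image of [Tz ^+ k], of dimension n j, is the kernel of [Tz ^+ j]; [f] maps it
   onto the image of [(S - 1) ^+ k]. *)
have rk1 : (\rank ((S - 1) ^+ k) +
            \rank (kermx f :&: kermx (Tz ^+ j))%MS = n * j)%N.
  rewrite -(eqmxMfull _ f_full) -(intertwine_exp k homf) -(rkTz k).
  rewrite -(mxrank_mul_ker (Tz ^+ k) f); congr (_ + _)%N.
  by rewrite capmxC (cap_eqmx kerTz (eqmx_refl _)).
have rk2 := mxrank_mul_ker (kermx f) (Tz ^+ j).
have := rank_f 0%N; rewrite expr0 mulmx1 => rk3.
rewrite rk3 rank_f in rk2.
have := rank_alt_phi (leq_subr k q); rewrite -/j subKn // => rk4.
have := rank_alt_phi (leq0n q); rewrite !subn0 (tens_jordan_nilp (leqnn q)).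
rewrite mul0mx mxrank0 => rk5.
have h_gt0 : (0 < h)%N by rewrite def_h expn_gt0.
have eq_q : q = (k + j)%N by rewrite subnKC.
(* As q = 2h, the leftover j - h plus the truncated h - j is the truncated h - k. *)
have e1 : (n * j = (n - h) * j + h.-1 * j + j)%N.
  by rewrite -mulnDl -mulSnr; congr (_ * _)%N; lia.
have e2 : (h.-1 * q = h.-1 * k + h.-1 * j)%N by rewrite {1}eq_q mulnDr.
lia.
Qed.

End Resolution.

Lemma unip_rank_sym k :
  \rank ((S - 1) ^+ k) =
    (\rank (Tm ^+ k *m alt_mx K m) + (n - h) * (q - k) + (h - k))%N.
Proof.
have [pi [iota [iota' [[pi_full iota_free ker_pi] [C_pi J_iota def_iota]]]]] :=
  jordan_resolution charK def_h def_q eq_mn le_hn.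
have Rk := rank_sym_resolution pi_full iota_free ker_pi C_pi J_iota def_iota.
have [/Rk //| lt_qk] := leqP k q.
(* The formula at k = q shows that [S - 1] has q-th power 0, so both sides vanish beyond q. *)
have Sq : (S - 1) ^+ q = 0.
  apply/eqP; rewrite -mxrank_eq0 Rk // tens_jordan_nilp // mul0mx mxrank0 subnn.
  by rewrite muln0 add0n add0n subn_eq0 def_q leq_addr.
rewrite (nilp_exp0 Sq (ltnW lt_qk)) tens_jordan_nilp 1?ltnW // mul0mx !mxrank0.
have -> : (q - k = 0)%N by lia.
by lia.
Qed.

End SymmetricSquareRank.

Theorem theorem1p3 (K : fieldType) (charK : 2 \in [pchar K]%R)
    (alpha q : nat) (alpha_gt0 : 0 < alpha) (def_q : q = 2 ^ alpha)
    (gT : finGroupType) (x : gT) (ord_x : #[x]%g = q)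
    (n : nat) (n_gt : q %/ 2 < n) (n_le : n <= q) :
  let V := jordan_module K x in
  mx_rsim (sym_square (V n))
    (dadd_grepr
      (dadd_grepr (ext_square (V (q - n))) (muln_grepr (V q) (n - q %/ 2)))
      (V (q %/ 2))).
Proof.
move=> V; have ox : #[x]%g = 2 ^ alpha by rewrite ord_x.
have VE i : i <= q -> V i x = jordan_block K i.
  by rewrite def_q; apply: jordan_moduleE.
apply: (cycle_rsim charK ox) => k.
have half_q : q = q %/ 2 + q %/ 2.
  by rewrite addnn -muln2 divnK // def_q dvdn_exp.
have half_pow : q %/ 2 = 2 ^ alpha.-1.
  by rewrite def_q -(prednK alpha_gt0) expnS mulKn.
have rankV i : i <= q -> unip_rank (V i) k = i - k.
  by move=> le_iq; rewrite /unip_rank VE // rank_jordan.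
have h_gt0 : 0 < q %/ 2 by rewrite half_pow expn_gt0.
(* q is at least 2 because alpha > 0; this shape gives access to the ring Z/q. *)
have [q' eq_q] : exists q', q = q'.+2 by exists q.-2; lia.
have [p [p_full pS ker_p]] := sym_square_proj (V n).
rewrite !unip_rank_add unip_rank_muln !rankV //; last by lia.
rewrite (unip_rank_ext_square _ _ charK).
rewrite VE // in pS; rewrite VE ?leq_subr //.
rewrite /unip_rank.
move: half_q; rewrite {1}eq_q => half_q.
have eq_mn : q - n + n = q'.+2 by rewrite subnK.
have le_hn := ltnW n_gt.
rewrite (unip_rank_sym charK half_pow half_q eq_mn le_hn p_full ker_p pS).
by rewrite -eq_q.
Qed.
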